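(* Let $k$ be a field, $\mathfrak{g}$ a Lie algebra over $k$ and $m$ a positive integer. Then there exists a bijective correspondence between the space of all $m$-dimensional representations of $\mathfrak{g}$ (that is, Lie algebra homomorphisms $\mathfrak{g}\to\mathfrak{gl}(m,k)$) and the space of all algebra homomorphisms $\mathcal{A}(\mathfrak{gl}(m,k),\mathfrak{g})\to k$.
   Context: All vector spaces, algebras and tensor products are over an arbitrary field $k$; algebras are unital and algebra homomorphisms preserve units. $\mathfrak{gl}(m,k)$ is the Lie algebra of $m\times m$ matrices over $k$ with the commutator bracket. Definition of $\mathcal{A}(\mathfrak{h},\mathfrak{g})$ for a finite dimensional Lie algebra $\mathfrak{h}$ and an arbitrary Lie algebra $\mathfrak{g}$: let $\{e_1,\dots,e_n\}$ be a basis of $\mathfrak{h}$, with structure constants $[e_i,e_j]=\sum_{s=1}^n\tau_{i,j}^s e_s$, and let $\{f_i\mid i\in I\}$ be a basis of $\mathfrak{g}$, with $[f_i,f_j]=\sum_{u\in B_{i,j}}\beta_{i,j}^u f_u$, where each $B_{i,j}\subseteq I$ is finite. Then $\mathcal{A}(\mathfrak{h},\mathfrak{g}) := k[X_{si}\mid s=1,\dots,n,\ i\in I]/J$, where $J$ is the ideal generated by all polynomials $$\sum_{u\in B_{i,j}}\beta_{i,j}^u X_{au}-\sum_{s,t=1}^n\tau_{s,t}^a X_{si}X_{tj},\qquad a=1,\dots,n,\ i,j\in I.$$ *)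

(* Defs.v *)
From HB Require Import structures.
From mathcomp Require Import all_boot all_algebra.
From mathcomp Require Import finmap boolp.
From mathcomp Require Import monalg ring.

Set Implicit Arguments.
Unset Strict Implicit.
Unset Printing Implicit Defensive.

Import GRing.Theory.

Local Open Scope ring_scope.

Reserved Notation "[ 'lie' x , y ]" (format "[ 'lie'  x ,  y ]").
Reserved Notation "{ 'lie_morphism' g -> h }"
  (at level 0, g at level 98, h at level 99,
   format "{ 'lie_morphism'  g  ->  h }").

HB.mixin Record Lmodule_isLieAlgebra (k : fieldType) L of GRing.Lmodule k L := {
  lie : L -> L -> L;
  lie_linearl : forall y, linear (fun x => lie x y);
  lie_linearr : forall x, linear (lie x);
  liexx : forall x, lie x x = 0;
  lie_jacobi : forall x y z,
    lie x (lie y z) + lie y (lie z x) + lie z (lie x y) = 0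
}.

#[short(type="lieAlgType")]
HB.structure Definition LieAlgebra (k : fieldType) :=
  {L of GRing.Lmodule k L & Lmodule_isLieAlgebra k L}.

Notation "[ 'lie' x , y ]" := (lie x y) : ring_scope.

HB.mixin Record isLieMorphism (k : fieldType) (g h : lieAlgType k)
    (f : g -> h) := {
  lie_morphM : forall x y, f [lie x, y] = [lie f x, f y]
}.

HB.structure Definition LieMorphism (k : fieldType) (g h : lieAlgType k) :=
  {f of isLieMorphism k g h f & @GRing.Linear k g h *:%R f}.

Notation "{ 'lie_morphism' g -> h }" := (@LieMorphism.type _ g h) : type_scope.

Section MatrixLie.
Variables (k : fieldType) (m : nat).
Implicit Types x y z : 'M[k]_m.

Definition mx_commutator x y : 'M[k]_m := x *m y - y *m x.

Lemma mx_commutator_linearl y : linear (fun x => mx_commutator x y).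
Proof.
move=> a u v; rewrite /mx_commutator mulmxDl mulmxDr -scalemxAl -scalemxAr.
by rewrite scalerBr opprD addrACA.
Qed.

Lemma mx_commutator_linearr x : linear (mx_commutator x).
Proof.
move=> a u v; rewrite /mx_commutator mulmxDl mulmxDr -scalemxAl -scalemxAr.
by rewrite scalerBr opprD addrACA.
Qed.

Lemma mx_commutatorxx x : mx_commutator x x = 0.
Proof. exact: subrr. Qed.

Lemma mx_commutator_jacobi x y z :
  mx_commutator x (mx_commutator y z) + mx_commutator y (mx_commutator z x)
  + mx_commutator z (mx_commutator x y) = 0.
Proof.
rewrite /mx_commutator !mulmxBl !mulmxBr !mulmxA.
apply/matrixP=> i j.
have D (u v : 'M[k]_m) : (u + v) i j = u i j + v i j by rewrite mxE.
have N (u : 'M[k]_m) : (- u) i j = - u i j by rewrite mxE.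
by rewrite [RHS]mxE !(D, N); ring.
Qed.

HB.instance Definition _ := Lmodule_isLieAlgebra.Build k 'M[k]_m
  mx_commutator_linearl mx_commutator_linearr
  mx_commutatorxx mx_commutator_jacobi.

End MatrixLie.

Definition gl (k : fieldType) (m : nat) : lieAlgType k := 'M[k]_m.

Section Bases.
Variable k : fieldType.

Definition lin_indep (V : lmodType k) (I : choiceType) (b : I -> V) : Prop :=
  forall (s : {fset I}) (c : I -> k),
    \sum_(i <- s) c i *: b i = 0 -> forall i, i \in s -> c i = 0.

Definition spanning (V : lmodType k) (I : choiceType) (b : I -> V) : Prop :=
  forall v : V, exists (s : {fset I}) (c : I -> k),
    v = \sum_(i <- s) c i *: b i.

Definition is_basis (V : lmodType k) (I : choiceType) (b : I -> V) : Prop :=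
  lin_indep b /\ spanning b.

(* A finite basis of h together with its structure constants
   (so h is finite dimensional): fb_cst i j s is the coefficient of e_s. *)
Record fin_lie_basis (h : lieAlgType k) := FinLieBasis {
  fb_dim : nat;
  fb_vec :> 'I_fb_dim -> h;
  fb_basis : is_basis fb_vec;
  fb_cst : 'I_fb_dim -> 'I_fb_dim -> 'I_fb_dim -> k;
  fb_cstE : forall i j,
    [lie fb_vec i, fb_vec j] = \sum_(s < fb_dim) fb_cst i j s *: fb_vec s
}.

(* lb_supp i j is any finite set of indices over which [f_i, f_j] expands. *)
Record lie_basis (g : lieAlgType k) := LieBasis {
  lb_idx : choiceType;
  lb_vec :> lb_idx -> g;
  lb_basis : is_basis lb_vec;
  lb_supp : lb_idx -> lb_idx -> {fset lb_idx};
  lb_cst : lb_idx -> lb_idx -> lb_idx -> k;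
  lb_cstE : forall i j,
    [lie lb_vec i, lb_vec j] = \sum_(u <- lb_supp i j) lb_cst i j u *: lb_vec u
}.

End Bases.

Arguments fb_cst {k h} f i j s.
Arguments lb_supp {k g} l i j.
Arguments lb_cst {k g} l i j u.

Definition ideal_gen (A : comNzRingType) (G : A -> Prop) : pred A :=
  fun p => `[< exists s : seq (A * A),
    (forall x, x \in s -> G x.2) /\ p = \sum_(x <- s) x.1 * x.2 >].

Lemma ideal_gen_closed (A : comNzRingType) (G : A -> Prop) :
  1 \notin ideal_gen G -> idealr_closed (ideal_gen G).
Proof.
split=> //; first by apply/asboolP; exists [::]; rewrite big_nil; split.
move=> a u v /asboolP[s [sG ->]] /asboolP[t [tG ->]]; apply/asboolP.
exists ([seq (a * x.1, x.2) | x <- s] ++ t); split.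
  by move=> x; rewrite mem_cat => /orP[/mapP[y /sG yG ->]|/tG].
rewrite big_cat big_map mulr_sumr /=; congr (_ + _).
by apply: eq_bigr => x _; rewrite mulrA.
Qed.

Lemma ideal_gen_proper (A : comNzRingType) (G : A -> Prop) (B : comNzRingType)
    (c : {rmorphism A -> B}) :
  (forall p, G p -> c p = 0) -> 1 \notin ideal_gen G.
Proof.
move=> cG; apply/asboolP=> -[s [sG /(congr1 c)]].
rewrite rmorph1 rmorph_sum big_seq big1; first by move/eqP; rewrite oner_eq0.
by move=> x /sG/cG cx; rewrite rmorphM cx mulr0.
Qed.

Section IdealQuotAlg.
Variables (k : comNzRingType) (A : comAlgType k) (J : idealr A).

Local Notation Q := {ideal_quot J}.

Definition ideal_quot_scale (a : k) (x : Q) : Q := \pi_Q%qT (a%:A) * x.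

Lemma ideal_quot_scaleA a b x :
  ideal_quot_scale a (ideal_quot_scale b x) = ideal_quot_scale (a * b) x.
Proof. by rewrite /ideal_quot_scale mulrA -rmorphM -scalerAl mul1r scalerA. Qed.

Lemma ideal_quot_scale1 : left_id 1 ideal_quot_scale.
Proof. by move=> x; rewrite /ideal_quot_scale scale1r rmorph1 mul1r. Qed.

Lemma ideal_quot_scaleDr : right_distributive ideal_quot_scale +%R.
Proof. by move=> a x y; exact: mulrDr. Qed.

Lemma ideal_quot_scaleDl x : {morph ideal_quot_scale^~ x : a b / a + b}.
Proof. by move=> a b; rewrite /ideal_quot_scale scalerDl rmorphD mulrDl. Qed.

HB.instance Definition _ := GRing.Zmodule_isLmodule.Build k Q
  ideal_quot_scaleA ideal_quot_scale1 ideal_quot_scaleDr ideal_quot_scaleDl.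

Lemma ideal_quot_scaleAl (a : k) (x y : Q) : a *: (x * y) = a *: x * y.
Proof. exact: mulrA. Qed.

HB.instance Definition _ :=
  GRing.Lmodule_isLalgebra.Build k Q ideal_quot_scaleAl.

HB.instance Definition _ := GRing.Lalgebra_isComAlgebra.Build k Q.

Lemma pi_scale (a : k) (p : A) : \pi_Q%qT (a *: p) = a *: \pi_Q%qT p.
Proof. by rewrite -[X in a *: X]mul1r scalerAl rmorphM. Qed.

End IdealQuotAlg.

Section UniversalAlgebra.
Variables (k : fieldType) (h g : lieAlgType k).
Variables (e : fin_lie_basis h) (f : lie_basis g).

Local Notation n := (fb_dim e).
Local Notation I := (lb_idx f).

(* k[X_{si}] on the possibly infinite set of variables 'I_n * I, as the monoid
   algebra of the free commutative monoid on that set. *)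
Local Notation univ_poly := {malg k[{cmonom ('I_n * I)%type}]}.

Definition univ_var (s : 'I_n) (i : I) : univ_poly := << ucm (s, i) >>.

Definition univ_rel (a : 'I_n) (i j : I) : univ_poly :=
  \sum_(u <- lb_supp f i j) lb_cst f i j u *: univ_var a u
  - \sum_(s < n) \sum_(t < n)
      fb_cst e s t a *: (univ_var s i * univ_var t j).

Definition univ_ideal : pred univ_poly :=
  ideal_gen (fun p => exists a i j, p = univ_rel a i j).

(* The relations have no constant term, hence 1 is not in the ideal. *)
Lemma univ_ideal_closed : idealr_closed univ_ideal.
Proof.
have [c cE] : exists c : {rmorphism univ_poly -> k}, c =1 mcoeff mone.
  by exists (mcoeff mone).
apply/ideal_gen_closed/(ideal_gen_proper (c := c)) => _ [a [i [j ->]]].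
have cvar b l : c (univ_var b l) = 0.
  rewrite cE mcoeffU; case: eqP => // /(congr1 (fun w => cmonom_val w (b, l))).
  by rewrite [LHS]ucmE eqxx [RHS]onecmE.
have cZ (b : k) (p : univ_poly) : c p = 0 -> c (b *: p) = 0.
  by rewrite !cE mcoeffZ => ->; rewrite mulr0.
rewrite rmorphB !rmorph_sum [X in X - _]big1 => [|u _]; last exact: cZ.
rewrite big1 ?subrr // => s _; rewrite rmorph_sum big1 // => t _.
by apply: cZ; rewrite rmorphM [X in X * _]cvar mul0r.
Qed.

HB.instance Definition _ := isIdealr.Build univ_poly univ_ideal univ_ideal_closed.

Definition univ_alg : comAlgType k := {ideal_quot (univ_ideal : idealr univ_poly)}.

End UniversalAlgebra.

Arguments univ_var {k h g} e f s i.
Arguments univ_rel {k h g} e f a i j.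
Arguments univ_ideal {k h g} e f p.
Arguments univ_alg {k} h g e f.

(* Main.v *)
Require Import Defs.
From HB Require Import structures.
From mathcomp Require Import all_boot all_algebra.
From mathcomp Require Import finmap boolp monalg.

Set Implicit Arguments.
Unset Strict Implicit.
Unset Printing Implicit Defensive.

Import GRing.Theory.

Local Open Scope ring_scope.

(* A representation rho is determined by the coordinates x_{s,i} of the rho(f_i)
   in the basis e, and an algebra morphism u from A(h, g) to k by the scalars
   u(X_{s,i}).  Arbitrary scalars x_{s,i} extend to a linear map g -> h and to
   an algebra morphism on k[X_{s,i}].  The a-th coordinate of
   rho[f_i, f_j] - [rho f_i, rho f_j] is the value at x of the defining relation
   indexed by (a, i, j), so one extension is a Lie morphism exactly when the
   other one factors through A(h, g). *)

(** * Extensionality of morphisms, and bijections from injectivity and surjectivity *)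

Lemma lie_morphism_ext (k : fieldType) (g h : lieAlgType k)
    (u v : {lie_morphism g -> h}) : u =1 v -> u = v.
Proof.
case: u v => [u [[uM] [uD] [uZ]]] [v [[vM] [vD] [vZ]]] /= /funext uv.
move: uM uD uZ vM vD vZ; rewrite {}uv => uM uD uZ vM vD vZ.
(* With a common underlying function, the remaining fields are proofs of propositions. *)
by congr (LieMorphism.Pack (LieMorphism.Class _ _ _));
   congr (_ _); apply: Prop_irrelevance.
Qed.

Lemma lrmorphism_ext (R : pzRingType) (A B : lalgType R)
    (u v : {lrmorphism A -> B}) : u =1 v -> u = v.
Proof.
case: u v => [u [[uD] [uM] [uZ]]] [v [[vD] [vM] [vZ]]] /= /funext uv.
move: uM uD uZ vM vD vZ; rewrite {}uv => uM uD uZ vM vD vZ.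
by congr (GRing.LRMorphism.Pack (GRing.LRMorphism.Class _ _ _));
   congr (_ _); apply: Prop_irrelevance.
Qed.

(** Choice turns surjectivity into a right inverse, which injectivity makes two-sided. *)
Lemma bijective_of_inj_surj (S T : Type) (F : S -> T) :
  injective F -> (forall y, exists x, F x = y) -> bijective F.
Proof.
move=> Finj /choice[G GK]; exists G => // x.
by apply: Finj; rewrite GK.
Qed.

(** * Linear maps and coordinates on a possibly infinite basis *)

Section Bases.
Variable k : fieldType.

Lemma big_fset_extend (V : lmodType k) (I : choiceType) (y : I -> V)
    (s t : {fset I}) (c : I -> k) : (s `<=` t)%fset ->
  \sum_(i <- s) c i *: y i
  = \sum_(i <- t) (if i \in s then c i else 0) *: y i.
Proof.
move=> st; rewrite -(big_fset_incl _ st) /=.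
  by apply: eq_big_seq => i ->.
by move=> i _ /negPf->; rewrite scale0r.
Qed.

(** The extension is first built as a relation [R], its graph: spanning makes [R] total, freeness
    makes it single-valued, and choice extracts the function. *)
Lemma basis_lift (V W : lmodType k) (I : choiceType) (b : I -> V)
    (y : I -> W) : is_basis b ->
  exists F : {linear V -> W}, forall i, F (b i) = y i.
Proof.
move=> [bfree bspan].
pose R v w := exists (s : {fset I}) (c : I -> k),
  v = \sum_(i <- s) c i *: b i /\ w = \sum_(i <- s) c i *: y i.
have RP a v w v' w' : R v w -> R v' w' -> R (a *: v + v') (a *: w + w').
  move=> [s [c [-> ->]]] [t [d [-> ->]]].
  (* Extension by zero lets both combinations run over the union of their supports. *)
  pose cs i := if i \in s then c i else 0.
  pose dt i := if i \in t then d i else 0.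
  exists (s `|` t)%fset, (fun i => a * cs i + dt i).
  rewrite !(big_fset_extend _ c (fsubsetUl s t)).
  rewrite !(big_fset_extend _ d (fsubsetUr s t)).
  by split; rewrite scaler_sumr -big_split /=; apply: eq_bigr => i _;
    rewrite scalerA scalerDl.
have R0 w : R 0 w -> w = 0.
  move=> [s [c [/esym/bfree c0 ->]]]; rewrite big_seq big1 // => i /c0->.
  by rewrite scale0r.
have Rfun v w w' : R v w -> R v w' -> w = w'.
  move=> Rw Rw'; apply/eqP; rewrite -subr_eq0; apply/eqP/R0.
  rewrite -[X in R X](subrr v) addrC -scaleN1r [w - w']addrC -[- w']scaleN1r.
  exact: RP.
have /choice[F FR] v : exists w, R v w.
  by have [s [c ->]] := bspan v; exists (\sum_(i <- s) c i *: y i), s, c.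
have Flin : linear F by move=> a v v'; apply: Rfun (FR _) (RP _ _ _ _ _ _ _).
pose linF := GRing.isLinear.Build k V W *:%R F Flin.
pose FL : {linear V -> W} := HB.pack F linF.
exists FL => i; apply: Rfun (FR _) _; exists [fset i]%fset, (fun=> 1).
by rewrite !big_seq_fset1 !scale1r.
Qed.

Lemma basis_linear_ext (V W : lmodType k) (I : choiceType) (b : I -> V)
    (F G : {linear V -> W}) :
  is_basis b -> (forall i, F (b i) = G (b i)) -> F =1 G.
Proof.
move=> [_ bspan] FG v; have [s [c ->]] := bspan v.
by rewrite !linear_sum; apply: eq_bigr => i _; rewrite !linearZ FG.
Qed.

(** The coordinate forms are the lifts of the Kronecker deltas; finiteness of [I] allows the
    expansion to be summed over all indices. *)
Lemma dual_basis (V : lmodType k) (I : finType) (b : I -> V) :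
  is_basis b -> exists F : I -> {linear V -> k^o},
    (forall i j, F i (b j) = (i == j)%:R) /\
    (forall v, v = \sum_i F i v *: b i).
Proof.
move=> bB.
have /choice[F Fb] i : exists F : {linear V -> k^o},
  forall j, F (b j) = (i == j)%:R by exact: basis_lift.
exists F; split=> // v.
have [s [c ->]] := bB.2 v.
transitivity (\sum_(j <- s) c j *: \sum_i F i (b j) *: b i).
  apply: eq_bigr => j _; rewrite (bigD1 j) //= Fb eqxx scale1r big1 ?addr0 //.
  by move=> i /negPf ij; rewrite Fb ij scale0r.
under eq_bigr do rewrite scaler_sumr.
rewrite exchange_big; apply: eq_bigr => i _.
rewrite linear_sum scaler_suml; apply: eq_bigr => j _.
by rewrite scalerA [in RHS]linearZ.
Qed.

End Bases.

(** * Brackets of linear combinations, and Lie morphisms tested on a basis *)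

Section LieSums.
Variables (k : fieldType) (h : lieAlgType k).

Lemma lie_suml I (r : seq I) (c : I -> k) (F : I -> h) y :
  [lie \sum_(i <- r) c i *: F i, y] = \sum_(i <- r) c i *: [lie F i, y].
Proof.
pose L : {linear h -> h} := HB.pack (fun x : h => [lie x, y])
  (GRing.isLinear.Build k h h *:%R _ (lie_linearl y)).
by rewrite -[LHS]/(L _) linear_sum; apply: eq_bigr => i _; rewrite linearZ.
Qed.

Lemma lie_sumr I (r : seq I) (c : I -> k) (F : I -> h) x :
  [lie x, \sum_(i <- r) c i *: F i] = \sum_(i <- r) c i *: [lie x, F i].
Proof.
pose L : {linear h -> h} := HB.pack (lie x)
  (GRing.isLinear.Build k h h *:%R _ (lie_linearr x)).
by rewrite -[LHS]/(L _) linear_sum; apply: eq_bigr => i _; rewrite linearZ.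
Qed.

End LieSums.

Lemma basis_lie_morphism (k : fieldType) (g h : lieAlgType k) (I : choiceType)
    (b : I -> g) (F : {linear g -> h}) : is_basis b ->
  (forall i j, F [lie b i, b j] = [lie F (b i), F (b j)]) ->
  exists G : {lie_morphism g -> h}, G =1 F.
Proof.
move=> [_ bspan] Fb.
have FM x y : F [lie x, y] = [lie F x, F y].
  have [s [c ->]] := bspan x; have [t [d ->]] := bspan y.
  rewrite lie_suml !linear_sum.
  under [X in [lie X, _]]eq_bigr do rewrite linearZ.
  under [X in [lie _, X]]eq_bigr do rewrite linearZ.
  rewrite lie_suml; apply: eq_bigr => i _; rewrite linearZ; congr (_ *: _).
  rewrite !lie_sumr linear_sum; apply: eq_bigr => j _.
  by rewrite linearZ; congr (_ *: _).
pose G : {lie_morphism g -> h} :=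
  LieMorphism.Pack (LieMorphism.Class (isLieMorphism.Build k g h F FM)
    (GRing.isNmodMorphism.Build g h F (raddf0 F, raddfD F))
    (GRing.isScalable.Build k g h *:%R F (linearZZ F))).
by exists G.
Qed.

(** * Evaluation and extensionality on polynomial algebras *)

Lemma malgZU (K : monomType) (R : nzRingType) (c : R) (m : K) :
  << c *g m >> = c *: << m >> :> {malg R[K]}.
Proof. by apply/malgP => l; rewrite mcoeffU mcoeffZ mcoeffU mulrnAr mulr1. Qed.

Lemma malgMU (K : monomType) (R : nzRingType) (m m' : K) :
  << mmul m m' >> = << m >> * << m' >> :> {malg R[K]}.
Proof. by rewrite -[RHS]/(fgmul _ _) fgmulUU mulr1. Qed.

Section MonomialAlgebra.
Variables (J : choiceType) (R : comNzRingType).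

(** Induction on the degree: a monomial other than [mone] is divisible by any variable of its
    support. *)
Lemma cmonom_ind (P : {cmonom J} -> Prop) :
  P mone -> (forall i m, P m -> P (mmul (ucm i) m)) -> forall m, P m.
Proof.
move=> P1 PM m; have [n] := ubnP (mdeg m); elim: n m => // n IHn m.
have [->//|] := eqVneq m mone; rewrite -mdeg_eq0 => m_neq0.
have [i im] : exists i, i \in finsupp m.
  apply/fset0Pn; apply: contraNneq m_neq0 => m0.
  by rewrite mdegE m0 big_seq_fset0.
have -> : m = mmul (ucm i) (divcm m (ucm i)).
  apply/eqP/cmP => j; rewrite cmM divcmE cmU subnKC //.
  by case: eqP => // <-; rewrite lt0n cmE_neq0.
by rewrite mdegM mdegU => mn; apply/PM/IHn.
Qed.

Definition monom_eval (x : J -> R) (m : {cmonom J}) : R :=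
  \prod_(j <- finsupp m) x j ^+ m j.

(** Exponents vanish off the support, so the extra factors are 1. This puts two monomials over a
    common index set when they are multiplied. *)
Lemma monom_evalEw (x : J -> R) (m : {cmonom J}) (d : {fset J}) :
  (finsupp m `<=` d)%fset -> monom_eval x m = \prod_(j <- d) x j ^+ m j.
Proof.
move=> md; rewrite /monom_eval (big_fset_incl _ md) // => j _.
by rewrite -cmE_eq0 => /eqP->.
Qed.

Lemma monom_eval_mmorphism (x : J -> R) : mmorphism (monom_eval x).
Proof.
split=> [m1 m2|]; last by rewrite /monom_eval mdom1 big_seq_fset0.
rewrite [LHS]/monom_eval mdomD (monom_evalEw x (fsubsetUl _ (finsupp m2))).
rewrite (monom_evalEw x (fsubsetUr (finsupp m1) _)) -big_split /=.
by apply: eq_bigr => j _; rewrite cmM exprD.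
Qed.

Lemma malg_eval (x : J -> R) :
  exists ev : {lrmorphism {malg R[{cmonom J}]} -> R^o},
    forall j, ev << ucm j >> = x j.
Proof.
pose h : {mmorphism {cmonom J} -> R} :=
  HB.pack (monom_eval x)
    (isMultiplicative.Build _ _ _ (monom_eval_mmorphism x)).
pose f : {malg R[{cmonom J}]} -> R^o := mmap idfun h.
have fD : nmod_morphism f by split; [exact: raddf0 | exact: raddfD].
have fM : monoid_morphism f by split; [exact: rmorph1 | exact: rmorphM].
have fZ : scalable f by move=> c p; exact: mmapZ.
pose ev : {lrmorphism {malg R[{cmonom J}]} -> R^o} := HB.pack f
  (GRing.isNmodMorphism.Build _ _ _ fD) (GRing.isMonoidMorphism.Build _ _ _ fM)
  (GRing.isScalable.Build _ _ _ _ _ fZ).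
exists ev => j; rewrite -[LHS]/(mmap idfun h _) mmapU /= mul1r.
by rewrite /monom_eval mdomU big_seq_fset1 cmUU expr1.
Qed.

Lemma malg_lrmorphism_ext (B : lalgType R)
    (u v : {lrmorphism {malg R[{cmonom J}]} -> B}) :
  (forall j, u << ucm j >> = v << ucm j >>) -> u =1 v.
Proof.
move=> uv p; rewrite [p]monalgE !linear_sum; apply: eq_bigr => m _.
rewrite malgZU !linearZ; congr (_ *: _); elim/cmonom_ind: m => [|j m IHm].
  by rewrite !rmorph1.
rewrite malgMU [LHS]rmorphM [RHS]rmorphM.
by congr (_ * _); [exact: uv | exact: IHm].
Qed.

End MonomialAlgebra.

(** * Factoring algebra morphisms through a quotient *)

Section IdealQuotient.
Variables (R : comNzRingType) (A : comAlgType R) (J : idealr A).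

Lemma ideal_quot_lift (B : lalgType R) (u : {lrmorphism A -> B}) :
  (forall p, p \in J -> u p = 0) ->
  exists v : {lrmorphism {ideal_quot J} -> B},
    forall p, v (\pi_{ideal_quot J}%qT p) = u p.
Proof.
(* The value is read off the chosen representative; [vpi] shows that any other one gives the same
   value, their difference being in [J]. *)
move=> uJ; pose v (q : {ideal_quot J}) : B := u (repr q).
have vpi p : v (\pi_{ideal_quot J}%qT p) = u p.
  apply/eqP; rewrite -subr_eq0 -rmorphB; apply/eqP/uJ.
  by rewrite Quotient.idealrBE reprK.
have vD : nmod_morphism v.
  split; first by rewrite -(rmorph0 (\pi_{ideal_quot J}%qT)) vpi rmorph0.
  by elim/quotW=> p; elim/quotW=> q; rewrite -rmorphD !vpi rmorphD.
have vM : monoid_morphism v.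
  split; first by rewrite -(rmorph1 (\pi_{ideal_quot J}%qT)) vpi rmorph1.
  by elim/quotW=> p; elim/quotW=> q; rewrite -rmorphM !vpi rmorphM.
have vZ : scalable v.
  by move=> a; elim/quotW=> p; rewrite -pi_scale !vpi linearZ.
pose w : {lrmorphism {ideal_quot J} -> B} := HB.pack v
  (GRing.isNmodMorphism.Build _ _ _ vD) (GRing.isMonoidMorphism.Build _ _ _ vM)
  (GRing.isScalable.Build _ _ _ _ _ vZ).
by exists w.
Qed.

End IdealQuotient.

(** * Algebra morphisms from A(h, g) to k as solutions of the defining relations *)

Section UniversalProperty.
Variables (k : fieldType) (h g : lieAlgType k).
Variables (e : fin_lie_basis h) (f : lie_basis g).

Local Notation n := (fb_dim e).
Local Notation I := (lb_idx f).
Local Notation U := (univ_alg h g e f).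
Local Notation univ_poly := {malg k[{cmonom ('I_n * I)%type}]}.

(** The projection is named with codomain [U] so that it carries its own algebra morphism structure
    and composes with morphisms out of [U]. *)
Definition univ_pi (p : univ_poly) : U :=
  \pi_{ideal_quot (univ_ideal e f : idealr univ_poly)}%qT p.

Lemma univ_pi_nmod_morphism : nmod_morphism univ_pi.
Proof. by split; [exact: rmorph0 | exact: rmorphD]. Qed.

Lemma univ_pi_monoid_morphism : monoid_morphism univ_pi.
Proof. by split; [exact: rmorph1 | exact: rmorphM]. Qed.

Lemma univ_pi_scalable : scalable univ_pi.
Proof. exact: pi_scale. Qed.

HB.instance Definition _ :=
  GRing.isNmodMorphism.Build univ_poly U univ_pi univ_pi_nmod_morphism.
HB.instance Definition _ :=
  GRing.isMonoidMorphism.Build univ_poly U univ_pi univ_pi_monoid_morphism.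
HB.instance Definition _ :=
  GRing.isScalable.Build k univ_poly U *:%R univ_pi univ_pi_scalable.

Definition univ_gen (s : 'I_n) (i : I) : U := univ_pi (univ_var e f s i).

Lemma univ_alg_ext (u v : {lrmorphism U -> k^o}) :
  (forall s i, u (univ_gen s i) = v (univ_gen s i)) -> u = v.
Proof.
move=> uv; apply: lrmorphism_ext; elim/quotW=> p.
apply: (@malg_lrmorphism_ext _ k k^o (u \o univ_pi) (v \o univ_pi)) => -[s i].
exact: uv.
Qed.

Definition rel_eval (x : 'I_n -> I -> k) a i j : k :=
  \sum_(u <- lb_supp f i j) lb_cst f i j u * x a u
  - \sum_(s < n) \sum_(t < n) fb_cst e s t a * (x s i * x t j).

(** Used twice: for evaluation at a point, and for a morphism on [U] pulled back along [univ_pi]. *)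
Lemma rmorph_univ_rel (u : {lrmorphism univ_poly -> k^o}) a i j :
  u (univ_rel e f a i j) = rel_eval (fun s l => u (univ_var e f s l)) a i j.
Proof.
rewrite linearB; apply: (congr2 (fun x y : k => x - y)).
  by rewrite linear_sum; apply: eq_bigr => l _; rewrite linearZ.
rewrite linear_sum; apply: eq_bigr => s _.
rewrite linear_sum; apply: eq_bigr => t _.
by rewrite linearZ; apply: (congr1 (fun x : k => _ * x)); exact: rmorphM.
Qed.

Lemma univ_alg_lift (x : 'I_n -> I -> k) :
  (forall a i j, rel_eval x a i j = 0) ->
  exists u : {lrmorphism U -> k^o}, forall s i, u (univ_gen s i) = x s i.
Proof.
move=> x0; have [ev evE] := malg_eval (fun si => x si.1 si.2).
have ev_rel a i j : ev (univ_rel e f a i j) = 0.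
  rewrite rmorph_univ_rel -[RHS](x0 a i j); congr rel_eval.
  by apply/funext => s; apply/funext => l; exact: (evE (s, l)).
have [|u uE] := @ideal_quot_lift k univ_poly
    (univ_ideal e f : idealr univ_poly) _ ev.
  (* Killing the generators is enough, since [p] is a combination of them. *)
  move=> p /asboolP[r [rG ->]]; rewrite rmorph_sum big_seq big1 // => q /rG.
  by move=> [a [i [j ->]]]; rewrite [LHS]rmorphM [X in _ * X]ev_rel mulr0.
by exists u => s i; rewrite -[RHS](evE (s, i)) -uE.
Qed.

Lemma univ_gen_rel (u : {lrmorphism U -> k^o}) a i j :
  rel_eval (fun s l => u (univ_gen s l)) a i j = 0.
Proof.
have pi0 : univ_pi (univ_rel e f a i j) = 0.
  apply/eqP; rewrite -(rmorph0 univ_pi) -Quotient.idealrBE subr0.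
  apply/asboolP; exists [:: (1, univ_rel e f a i j)]; split.
    by move=> x; rewrite inE => /eqP->; exists a, i, j.
  by rewrite big_seq1 mul1r.
by rewrite -(rmorph_univ_rel (u \o univ_pi)) /= pi0 rmorph0.
Qed.

End UniversalProperty.

(** * The bijection between Lie morphisms and algebra morphisms *)

Section Correspondence.
Variables (k : fieldType) (h g : lieAlgType k).
Variables (e : fin_lie_basis h) (f : lie_basis g).

Local Notation n := (fb_dim e).
Local Notation I := (lb_idx f).
Local Notation U := (univ_alg h g e f).

Lemma lie_morphism_univ_alg_bijection :
  exists Phi : {lie_morphism g -> h} -> {lrmorphism U -> k^o}, bijective Phi.
Proof.
have [co [coE coK]] := dual_basis (fb_basis e).
have co_inj v w : (forall s, co s v = co s w) -> v = w.
  by move=> vw; rewrite [v]coK [w]coK; apply: eq_bigr => s _; rewrite vw.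
have co_comb (c : 'I_n -> k) s : co s (\sum_t c t *: e t) = c s.
  rewrite linear_sum (bigD1 s) //= linearZ big1 ?addr0 /= => [|t /negPf ts].
    by rewrite coE eqxx; exact: mulr1.
  by rewrite linearZ coE eq_sym ts; exact: mulr0.
have co_lie a v w : co a [lie v, w]
    = \sum_s \sum_t fb_cst e s t a * (co s v * co t w).
  rewrite {1}[v]coK {1}[w]coK lie_suml linear_sum; apply: eq_bigr => s _.
  rewrite linearZ lie_sumr linear_sum /= scaler_sumr; apply: eq_bigr => t _.
  rewrite linearZ fb_cstE co_comb /=.
  (* Scaling in [k^o] is multiplication in [k], by conversion. *)
  by rewrite -[LHS]/(co s v * (co t w * _)) mulrA mulrC.
(* Stated for a merely linear [rho], so that it serves both to define [Phi] and to recognise Lie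
   morphisms in the surjectivity argument. *)
have co_rel (rho : {linear g -> h}) a i j :
    rel_eval (fun s l => co s (rho (f l))) a i j
    = co a (rho [lie f i, f j]) - co a [lie rho (f i), rho (f j)].
  rewrite lb_cstE !linear_sum co_lie; congr (_ - _).
  by apply: eq_bigr => l _; rewrite !linearZ.
have /choice[Phi PhiE] (rho : {lie_morphism g -> h}) :
    exists u : {lrmorphism U -> k^o},
      forall s i, u (univ_gen s i) = co s (rho (f i)).
  apply: univ_alg_lift => a i j; rewrite co_rel; apply/eqP.
  by rewrite subr_eq0; apply/eqP; congr (co a _); exact: lie_morphM.
exists Phi; apply: bijective_of_inj_surj => [rho rho' eqPhi|u].
  apply: lie_morphism_ext; apply: (basis_linear_ext (lb_basis f)) => i.
  by apply: co_inj => s; rewrite -!PhiE eqPhi.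
(* Surjectivity: the preimage of [u] is the linear map whose coordinates on the basis [f] are the
   values of [u] on the generators. *)
have [rho0 rho0E] := basis_lift
  (fun i => \sum_s (u (univ_gen s i) : k) *: e s : h)
  (lb_basis f).
have coE0 s i : co s (rho0 (f i)) = u (univ_gen s i) by rewrite rho0E co_comb.
have [rho rhoE] : exists rho : {lie_morphism g -> h}, rho =1 rho0.
  apply: (basis_lie_morphism (lb_basis f)) => i j; apply: co_inj => a.
  apply/eqP; rewrite -subr_eq0 -co_rel; apply/eqP.
  rewrite -[RHS](univ_gen_rel u a i j).
  apply: (congr1 (fun x => rel_eval x a i j)).
  by apply/funext => s; apply/funext => l; exact: coE0.
by exists rho; apply: univ_alg_ext => s i; rewrite PhiE rhoE coE0.
Qed.

End Correspondence.

Theorem corollary2p4 (k : fieldType) (g : lieAlgType k) (m : nat)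
    (m_gt0 : (0 < m)%N) (e : fin_lie_basis (gl k m)) (f : lie_basis g) :
  exists Phi : {lie_morphism g -> gl k m} ->
               {lrmorphism univ_alg (gl k m) g e f -> k^o},
    bijective Phi.
Proof. exact: lie_morphism_univ_alg_bijection. Qed.
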